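(* Let $S$ be a range set with countable coinitiality. Let $X$ be an $S$-valued ultrametrizable topological space. Then $X$ is compact if and only if every ultrametric $d\in\mathrm{UM}(X,S)$ is complete.
   Context: A range set is a set $S\subseteq[0,\infty)$ with $0\in S$; it has countable coinitiality if there is a strictly decreasing sequence $\{r_i\}_{i\in\mathbb{N}}$ in $S$ with $\lim_{i\to\infty}r_i=0$. A metric $d$ on $X$ is an ultrametric if $d(x,y)\le \max\{d(x,z),d(z,y)\}$ for all $x,y,z$; it is $S$-valued if $d(X^2)\subseteq S$. For a topological space $X$, $\mathrm{UM}(X,S)$ denotes the set of all $S$-valued ultrametrics on $X$ that generate the topology of $X$; $X$ is $S$-valued ultrametrizable if $\mathrm{UM}(X,S)\neq\emptyset$. *)

(* Defs.v *)
From mathcomp Require Import all_boot all_order all_algebra.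
From mathcomp Require Import all_classical all_reals all_analysis.
Set Implicit Arguments.
Unset Strict Implicit.
Unset Printing Implicit Defensive.
Import Order.TTheory GRing.Theory Num.Theory.
Import numFieldNormedType.Exports.
Local Open Scope classical_set_scope.
Local Open Scope ring_scope.

Section range_sets.
Context {R : realType}.

Definition range_set (S : set R) : Prop :=
  S `<=` [set x | 0 <= x] /\ S 0.

(* [decreasing_seq] is the strict notion: r is anti-monotone and reflects the
   order, hence injective. *)
Definition countable_coinitiality (S : set R) : Prop :=
  exists r : nat -> R,
    [/\ forall i, S (r i), decreasing_seq r & r @ \oo --> (0 : R)].

End range_sets.

(* Distances are kept as functions, rather than as [metricType] structures,
   because several of them live on the same topological space. *)
Section metrics.
Context {R : realType} {T : Type}.
Implicit Type d : T -> T -> R.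

Record is_metric d : Prop := IsMetric {
  metric_ge0 : forall x y, 0 <= d x y ;
  metric_eq0 : forall x y, d x y = 0 <-> x = y ;
  metric_sym : forall x y, d x y = d y x ;
  metric_triangle : forall x y z, d x y <= d x z + d z y }.

Definition is_ultrametric d : Prop :=
  is_metric d /\ forall x y z, d x y <= Num.max (d x z) (d z y).

Definition valued_in (S : set R) d : Prop := forall x y, S (d x y).

Definition metric_ball d (x : T) (e : R) : set T := [set y | d x y < e].

Definition metric_cauchy d (u : nat -> T) : Prop :=
  forall e, 0 < e ->
    exists N, forall m n, (N <= m)%N -> (N <= n)%N -> d (u m) (u n) < e.

Definition metric_cvg d (u : nat -> T) (l : T) : Prop :=
  d (u n) l @[n --> \oo] --> (0 : R).

Definition metric_complete d : Prop :=
  forall u, metric_cauchy d u -> exists l, metric_cvg d u l.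

End metrics.

Section ultrametrizable.
Context {R : realType} (X : topologicalType).

Definition generates_topology (d : X -> X -> R) : Prop :=
  forall U : set X,
    open U <-> forall x, U x -> exists2 e, 0 < e & metric_ball d x e `<=` U.

Definition UM (S : set R) : set (X -> X -> R) :=
  [set d | [/\ is_ultrametric d, valued_in S d & generates_topology d]].

End ultrametrizable.

Arguments UM {R} X S.

Definition ultrametrizable (R : realType) (X : topologicalType) (S : set R) : Prop :=
  UM X S !=set0.

(* Main.v *)
(** If [X] is not compact although [d] is complete, then [d] is not totally
    bounded, so for some [e > 0] there are infinitely many disjoint classes of
    the equivalence relation [d x y < e]; labelling them gives a locally
    constant surjection [p : X -> nat].  Capping [d] by [r n] inside the fibre
    over [n] and putting the fibres over [m <> n] at distance [r (minn m n)]
    gives an S-valued ultrametric for the same topology, for which a section of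
    [p] is a Cauchy sequence without limit. *)
Require Import Defs.
From mathcomp Require Import all_boot all_order all_algebra.
From mathcomp Require Import all_classical all_reals all_analysis.
Set Implicit Arguments.
Unset Strict Implicit.
Unset Printing Implicit Defensive.
Import Order.TTheory GRing.Theory Num.Theory.
Import numFieldNormedType.Exports.
Local Open Scope classical_set_scope.
Local Open Scope ring_scope.

Lemma metric_cvgP (R : realType) (T : Type) (d : T -> T -> R) (u : nat -> T)
    (l : T) : is_metric d ->
  metric_cvg d u l <->
  forall e, 0 < e -> exists N, forall n, (N <= n)%N -> d (u n) l < e.
Proof.
move=> md; split=> [/cvgrPdist_lt ul e e0|ul].
  have [N _ HN] := ul e e0; exists N => n Nn.
  by have := HN n Nn; rewrite /= sub0r normrN ger0_norm ?(Defs.metric_ge0 md).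
apply/cvgrPdist_lt => e /ul[N HN]; exists N => // n /= Nn.
by rewrite sub0r normrN ger0_norm ?(Defs.metric_ge0 md) ?HN.
Qed.

Lemma ultrametric_lt_trans (R : realType) (T : Type) (d : T -> T -> R) x y z e :
  is_ultrametric d -> d x z < e -> d z y < e -> d x y < e.
Proof. by move=> ud xz zy; rewrite (le_lt_trans (ud.2 x y z))// gt_max xz. Qed.

Section generated_topology.
Context {R : realType} {X : topologicalType}.
Variable d : X -> X -> R.
Hypotheses (ud : is_ultrametric d) (gd : generates_topology d).

Lemma nbhs_metric_ballP x U :
  nbhs x U <-> exists2 e, 0 < e & metric_ball d x e `<=` U.
Proof.
rewrite nbhsE; split=> [[V [oV Vx] VU]|[e e0 xU]].
  by have [e e0 xV] := (gd V).1 oV x Vx; exists e => //; apply: subset_trans VU.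
exists (metric_ball d x e) => //; split; last first.
  by rewrite /metric_ball /= (Defs.metric_eq0 ud.1 x x).2.
(* The ball is open: by the strong triangle inequality the same radius [e] works at each of its
   points. *)
apply/gd => y xy; exists e => // z yz; exact: ultrametric_lt_trans ud xy yz.
Qed.

(** A Cauchy sequence converges to any of its cluster points: some late term is near the point, and
    all late terms are near that one. *)
Lemma compact_metric_complete : compact [set: X] -> metric_complete d.
Proof.
move=> cX u cu.
have [l [_ cl]] := cX (u @ \oo) _ filterT.
exists l; apply/(metric_cvgP u l ud.1) => e e0.
have [N HN] := cu e e0; exists N => n Nn.
have uN : (u @ \oo) [set u m | m in [set m | (N <= m)%N]].
  by exists N => // m /= Nm; exists m.
have lB : nbhs l (metric_ball d l e) by apply/nbhs_metric_ballP; exists e.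
have [_ [[m /= Nm <-]]] := cl _ _ uN lB; rewrite /metric_ball/= => lm.
apply: (ultrametric_lt_trans (z := (u m)) ud); first exact: HN.
by rewrite (Defs.metric_sym ud.1).
Qed.

(** An ultrafilter containing no [P x] contains all their complements, but the finitely many
    complements with [x] in [s] have empty intersection. *)
Lemma ultra_has_mem (F : set_system X) (P : X -> set X) (s : seq X) :
  UltraFilter F -> (forall y, exists2 x, x \in s & P x y) ->
  exists x, F (P x).
Proof.
move=> FU cov; apply: contrapT => /forallNP nF.
have : F (fun y => forall x, x \in s -> ~ P x y).
  elim: s {cov} => [|a s IH]; first by apply: filterE => y x.
  have [//|Fa] := in_ultra_setVsetC (P a) FU; first by move/nF.
  apply: filterS2 IH Fa => y sy ay x; rewrite inE => /orP[/eqP->//|]; exact: sy.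
move=> /filter_ex[y ny]; have [x xs Pxy] := cov y; exact: ny Pxy.
Qed.

(** An ultrafilter contains a ball of radius 1/(n+1) for every n. Two members of a filter meet, so
    the centres form a Cauchy sequence, and the ultrafilter converges to its limit. *)
Lemma totally_bounded_compact : metric_complete d ->
  (forall e, 0 < e -> exists s : seq X,
    forall y, exists2 x, x \in s & d x y < e) ->
  compact [set: X].
Proof.
move=> cd tb; rewrite compact_ultra => F FU _.
have /choice[u Fu] : forall n : nat,
    exists x, F (metric_ball d x (n.+1%:R^-1 : R)).
  move=> n; have [|s hs] := tb n.+1%:R^-1; first by rewrite invr_gt0.
  by apply: (@ultra_has_mem F (fun x => metric_ball d x n.+1%:R^-1) s FU).
have inv_lt (e : R) : 0 < e ->
    exists N : nat, forall n, (N <= n)%N -> n.+1%:R^-1 < e.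
  move=> e0; have [N _ HN] := near_infty_natSinv_lt (PosNum e0).
  by exists N => n /HN.
have [l] : exists l, metric_cvg d u l.
  apply: cd => e /inv_lt[N HN]; exists N => m n Nm Nn.
  have [y [/= my ny]] := filter_ex (filterI (Fu m) (Fu n)).
  apply: (ultrametric_lt_trans (z := y) ud); first exact: lt_trans my (HN _ Nm).
  by rewrite (Defs.metric_sym ud.1); apply: lt_trans ny (HN _ Nn).
move=> /(metric_cvgP u l ud.1) ul; exists l; split=> // U.
move=> /nbhs_metric_ballP[e e0 lU].
have [N HN] := ul e e0; have [M HM] := inv_lt e e0.
apply: filterS (Fu (maxn N M)) => y uy; apply: lU.
apply: (ultrametric_lt_trans (z := (u (maxn N M))) ud).
  by rewrite (Defs.metric_sym ud.1) HN// leq_maxl.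
by apply: lt_trans uy _; rewrite HM// leq_maxr.
Qed.

End generated_topology.

Lemma separated_sequence (R : realType) (T : choiceType) (d : T -> T -> R) (e : R) :
  (forall x y, d x y = d y x) ->
  (forall s : seq T, exists y, forall x, x \in s -> e <= d x y) ->
  exists u : nat -> T, forall m n, m != n -> e <= d (u m) (u n).
Proof.
move=> dC /choice[f hf].
(* Greedy choice: [s n] lists the first [n] points chosen, and [f (s n)] is the next one, at
   distance at least [e] from all of them. *)
pose s := fix s n := if n is m.+1 then f (s m) :: s m else [::].
have mem_s m n : (m < n)%N -> f (s m) \in s n.
  elim: n => // n IH; rewrite ltnS leq_eqVlt inE => /orP[/eqP->|/IH->].
    by rewrite eqxx.
  by rewrite orbT.
exists (f \o s) => m n /=; rewrite neq_ltn => /orP[] /mem_s h.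
  exact: hf.
by rewrite dC; exact: hf.
Qed.

Section fan.
Context {R : realType} {X : topologicalType}.
Variables (d : X -> X -> R) (r : nat -> R) (p : X -> nat).

(** The cap [r (p x)] is what the ultrametric inequality demands when a third point lies in a fibre
    with a larger label. *)
Definition fan_metric (x y : X) : R :=
  if p x == p y then Num.min (d x y) (r (p x)) else r (minn (p x) (p y)).

Hypotheses (ud : is_ultrametric d) (gd : generates_topology d).
Hypotheses (r_gt0 : forall n, 0 < r n) (r_decr : decreasing_seq r).

Lemma fan_metric_sym x y : fan_metric x y = fan_metric y x.
Proof.
rewrite /fan_metric eq_sym minnC (Defs.metric_sym ud.1).
by case: eqP => // ->.
Qed.

Lemma fan_metric_le_label x y : fan_metric x y <= r (minn (p x) (p y)).
Proof.
by rewrite /fan_metric; case: eqP => // ->; rewrite minnn ge_min lexx orbT.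
Qed.

Lemma fan_metric_label x y : p x != p y -> r (p x) <= fan_metric x y.
Proof. by rewrite /fan_metric => /negbTE->; rewrite r_decr geq_minl. Qed.

Lemma fan_metric_ultra x y z :
  fan_metric x y <= Num.max (fan_metric x z) (fan_metric z y).
Proof.
rewrite le_max; have [xz|xz] := eqVneq (p x) (p z); last first.
  have [zy|zy] := eqVneq (p z) (p y).
    apply/orP; left; apply: le_trans (fan_metric_le_label x y) _.
    by rewrite /fan_metric (negbTE xz) zy.
  (* Here [z] lies outside both fibres, and the endpoint with the smaller label is already far
     enough from [z]. *)
  apply/orP; case: (leqP (p x) (p y)) => xy.
    left; apply: le_trans (fan_metric_label xz).
    by apply: le_trans (fan_metric_le_label x y) _; rewrite (minn_idPl xy).
  right; rewrite (fan_metric_sym z); rewrite eq_sym in zy.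
  apply: le_trans (fan_metric_label zy).
  apply: le_trans (fan_metric_le_label x y) _.
  by rewrite (minn_idPr (ltnW xy)).
have [zy|zy] := eqVneq (p z) (p y); last first.
  apply/orP; right; apply: le_trans (fan_metric_le_label x y) _.
  by rewrite xz /fan_metric (negbTE zy).
(* All three points share one cap, and capping by a constant distributes over the maximum. *)
rewrite -le_max /fan_metric xz zy eqxx -min_maxl.
by rewrite le_min !ge_min lexx (ud.2 x y z) orbT.
Qed.

Lemma fan_metric_ultrametric : is_ultrametric fan_metric.
Proof.
have ge0 x y : 0 <= fan_metric x y.
  rewrite /fan_metric; case: ifP => _; last exact: ltW.
  by rewrite le_min (Defs.metric_ge0 ud.1) ltW.
split; last exact: fan_metric_ultra.
split=> //; last 2 first.
- exact: fan_metric_sym.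
- move=> x y z; apply: le_trans (fan_metric_ultra x y z) _.
  by rewrite ge_max lerDl lerDr !ge0.
move=> x y; split=> [|<-]; last first.
  rewrite /fan_metric eqxx (Defs.metric_eq0 ud.1 x x).2//.
  by rewrite min_l// ltW.
rewrite /fan_metric; case: ifP => _ h; last
  by have := r_gt0 (minn (p x) (p y)); rewrite h ltxx.
apply/(Defs.metric_eq0 ud.1); move: h; case: leP => // _ h.
by have := r_gt0 (p x); rewrite h ltxx.
Qed.

Lemma fan_metric_valued (S : set R) :
  (forall n, S (r n)) -> valued_in S d -> valued_in S fan_metric.
Proof.
by move=> Sr Sd x y; rewrite /fan_metric; case: ifP => // _; case: leP.
Qed.

(** Around [x], both metrics have the same balls of radius at most [e] and [r (p x)]: such balls
    stay in the fibre of [x], where the cap is then inactive. *)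
Lemma fan_metric_generates (e : R) : 0 < e ->
  (forall x y, d x y < e -> p x = p y) -> generates_topology fan_metric.
Proof.
move=> e0 pe U; rewrite gd; split=> oU x /oU[a a0 aU].
  exists (Num.min a (r (p x))); first by rewrite lt_min a0 r_gt0.
  move=> y; rewrite /metric_ball/= lt_min => /andP[xya xyr]; apply: aU.
  have xy : p x == p y.
    by apply/negPn/negP => /fan_metric_label; rewrite leNgt xyr.
  move: xyr xya; rewrite /fan_metric xy gt_min ltxx orbF => xyr.
  by rewrite min_l// ltW.
exists (Num.min a e); first by rewrite lt_min a0 e0.
move=> y; rewrite /metric_ball/= lt_min => /andP[xya /pe xy]; apply: aU.
by rewrite /metric_ball/= /fan_metric xy eqxx gt_min xya.
Qed.

(** The terms of index [m] and [n] are at distance at most [r (minn m n)], so [u] is Cauchy; but any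
    point with a label other than [p l] is at distance at least [r (p l)] from [l]. *)
Lemma fan_metric_not_complete (u : nat -> X) : r @ \oo --> (0 : R) ->
  (forall n, p (u n) = n) -> ~ metric_complete fan_metric.
Proof.
move=> r0 pu /(_ u)[|l].
  move=> e e0; have /cvgrPdist_lt /(_ e e0)[N _ HN] := r0.
  exists N => m n Nm Nn.
  apply: le_lt_trans (fan_metric_le_label _ _) _; rewrite !pu.
  have := HN (minn m n); rewrite /= leq_min Nm Nn sub0r normrN gtr0_norm//.
  exact.
move=> /(metric_cvgP u l fan_metric_ultrametric.1) /(_ _ (r_gt0 (p l))).
(* An index past [N] whose label exceeds [p l]. *)
move=> [N HN]; have := HN (maxn N (p l).+1) (leq_maxl _ _).
rewrite fan_metric_sym ltNge fan_metric_label// pu.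
by rewrite neq_ltn leq_maxr.
Qed.

End fan.

Lemma separated_labelling (R : realType) (X : Type) (d : X -> X -> R) (e : R)
    (u : nat -> X) : is_ultrametric d ->
  (forall m n, m != n -> e <= d (u m) (u n)) -> 0 < e ->
  exists p : X -> nat,
    (forall x y, d x y < e -> p x = p y) /\ (forall n, p (u n) = n).
Proof.
move=> ud sep e0.
(* By separation at most one [u n] is within [e] of [x]; points near none get the default label 0.
   The set of such [n] depends only on the class of [x]. *)
exists (fun x => xget 0%N [set n | d x (u n) < e]); split=> [x y xy|n].
  congr xget; apply/seteqP; split=> n /=; last exact: ultrametric_lt_trans.
  by apply: ultrametric_lt_trans => //; rewrite (Defs.metric_sym ud.1).
case: xgetP => [m _ /= h|/(_ n)]; last first.
  by rewrite /= (Defs.metric_eq0 ud.1 _ _).2.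
by apply/eqP/negPn/negP; rewrite eq_sym => /sep; rewrite leNgt h.
Qed.

Theorem corollary1p3 (R : realType) (S : set R) (X : topologicalType)
    (hS : range_set S) (hcoin : countable_coinitiality S)
    (hX : ultrametrizable X S) :
  compact [set: X] <-> forall d : X -> X -> R, UM X S d -> metric_complete d.
Proof.
split=> [cX d [ud _ gd]|cUM]; first exact: compact_metric_complete.
have [d [ud Sd gd]] := hX; have [r [Sr r_decr r0]] := hcoin.
(* Strict decrease: [r n] exceeds [r n.+1], which is nonnegative as an element of [S]. *)
have r_gt0 n : 0 < r n.
  apply: le_lt_trans (hS.1 _ (Sr n.+1)) _.
  by rewrite ltNge r_decr ltnn.
apply: (totally_bounded_compact ud gd); first exact: cUM.
move=> e e0; apply: contrapT => /forallNP ntb.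
(* Without a finite [e]-net, every finite list misses some point by at least [e]. *)
have [|u sep] := @separated_sequence R X d e (Defs.metric_sym ud.1).
  move=> s; have /existsNP[y ny] := ntb s; exists y => x xs.
  by rewrite leNgt; apply/negP => xy; apply: ny; exists x.
have [p [pe pu]] := separated_labelling ud sep e0.
apply: (fan_metric_not_complete ud r_gt0 r_decr r0 pu).
apply: cUM; split.
- exact: fan_metric_ultrametric.
- exact: fan_metric_valued.
- exact: (fan_metric_generates gd r_gt0 r_decr e0 pe).
Qed.
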